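(* Let $A\in\mathbb C^{N\times N}$ be unitary, let $C\in\mathbb C^{p\times N}$, and let $$\varphi(\lambda)=\tfrac12C(A-\lambda I_N)^{-1}(A+\lambda I_N)C^*$$ be a rational lossless function given by such a minimal realization. Let $f$ be the $\mathbb C^{p\times p}$-valued symmetric discrete analytic function in $\Lambda_{++}$ with characteristic function $\varphi$. Then $$f(m,0)=C(\sqrt{2}A^{-1}-iI_N)^mC^*,\qquad m=0,1,\ldots$$
   Context: $\Lambda_{++}=\mathbb N_0+i\mathbb N_0$, $f(m,n)=f(m+in)$; $f$ is discrete analytic if $f(m,n)+if(m+1,n)-if(m,n+1)-f(m+1,n+1)=0$ for all $m,n\in\mathbb N_0$, and symmetric if $f(m,0)=f(0,m)^*$ for all $m$. Let $\sigma(\lambda)=\frac{\sqrt2\lambda}{1+i\lambda}$. That $f$ has characteristic function $\varphi$ means that, in a neighborhood of the origin, $\varphi(\sigma(\lambda))=\Phi(\lambda)$ with $\Phi(\lambda)=(1+i\lambda)\sum_{m=0}^\infty f(m,0)\lambda^m-\frac{f(0,0)}2$. Rational lossless: $\varphi$ is $\mathbb C^{p\times p}$-valued rational, $\varphi(\lambda)+\varphi(\lambda)^*=0$ for $|\lambda|=1$ (away from poles) and $\mathrm{Re}\,\varphi(\lambda)\ge0$ for $|\lambda|<1$; such functions, when analytic at infinity and normalized by $\varphi(0)\ge0$, have a minimal realization (i.e. with the size $N$ of $A$ smallest possible) of the displayed form with $A$ unitary. *)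

(* Defs.v *)
From HB Require Import structures.
From mathcomp Require Import all_boot all_order all_algebra.
From mathcomp Require Import complex.
From mathcomp Require Import all_classical all_reals all_analysis.

Set Implicit Arguments.
Unset Strict Implicit.
Unset Printing Implicit Defensive.

Export Order.TTheory GRing.Theory Num.Theory.
Export numFieldNormedType.Exports.

Global Open Scope classical_set_scope.
Global Open Scope ring_scope.
Global Open Scope sesquilinear_scope.

(* R[i] declared as a numClosedFieldType, so that it carries the topology that
   MathComp-Analysis attaches to such fields, whose neighbourhoods of 0 are
   those of the modulus. *)
Definition cplx (R : realType) : numClosedFieldType := complex R.

(* A matrix-valued rational function is kept in lowest terms, so that its poles
   are exactly the roots of the denominator. *)
Record ratmx (K : fieldType) (p : nat) := RatMx {
  ratmx_num : 'M[{poly K}]_p;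
  ratmx_den : {poly K};
  ratmx_den_neq0 : ratmx_den != 0;
  ratmx_reduced : forall z : K, root ratmx_den z ->
    exists i, exists j, ~~ root (ratmx_num i j) z }.

Definition ratmx_pole (K : fieldType) p (phi : ratmx K p) (z : K) : bool :=
  root (ratmx_den phi) z.

(* Only meaningful when z is not a pole (it is 0 otherwise). *)
Definition ratmx_eval (K : fieldType) p (phi : ratmx K p) (z : K) : 'M[K]_p :=
  (ratmx_den phi).[z]^-1 *: map_mx (fun q : {poly K} => q.[z]) (ratmx_num phi).

(* In a numClosedFieldType, 0 <= x entails that x is real. *)
Definition psdmx (K : numClosedFieldType) p (M : 'M[K]_p) : Prop :=
  forall v : 'rV[K]_p, 0 <= (v *m M *m v^t*) 0 0.

Definition remx (K : numClosedFieldType) p (M : 'M[K]_p) : 'M[K]_p :=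
  2^-1 *: (M + M^t*).

Definition lossless (K : numClosedFieldType) p (phi : ratmx K p) : Prop :=
  (forall z : K, `|z| = 1 -> ~~ ratmx_pole phi z ->
     ratmx_eval phi z + (ratmx_eval phi z)^t* = 0) /\
  (forall z : K, `|z| < 1 ->
     ~~ ratmx_pole phi z /\ psdmx (remx (ratmx_eval phi z))).

(* Equality of rational functions: wherever both sides are defined. *)
Definition realizes (K : numClosedFieldType) p N (phi : ratmx K p)
    (A : 'M[K]_N) (C : 'M[K]_(p, N)) : Prop :=
  forall z : K, ~~ ratmx_pole phi z -> A - z%:M \in unitmx ->
    ratmx_eval phi z =
      2^-1 *: (C *m invmx (A - z%:M) *m (A + z%:M) *m C^t*).

Definition minimal_realization (K : numClosedFieldType) p N (phi : ratmx K p)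
    (A : 'M[K]_N) (C : 'M[K]_(p, N)) : Prop :=
  realizes phi A C /\
  (forall N' (A' : 'M[K]_N') (C' : 'M[K]_(p, N')),
     A' \is unitarymx -> realizes phi A' C' -> (N <= N')%N).

(* A function f on the quarter lattice is given by f m n, its value at m + in. *)
Definition discrete_analytic (K : numClosedFieldType) p
    (f : nat -> nat -> 'M[K]_p) : Prop :=
  forall m n, f m n + 'i *: f m.+1 n - 'i *: f m n.+1 - f m.+1 n.+1 = 0.

Definition symmetric_da (K : numClosedFieldType) p
    (f : nat -> nat -> 'M[K]_p) : Prop :=
  forall m, f m 0%N = (f 0%N m)^t*.

Definition sigma (K : numClosedFieldType) (z : K) : K :=
  sqrtC 2 * z / (1 + 'i * z).

Definition axis_series (K : numClosedFieldType) p
    (f : nat -> nat -> 'M[K]_p) (z : K) : nat -> 'M[K]_p :=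
  series (fun m => z ^+ m *: f m 0%N).

Definition Phi (K : numClosedFieldType) p
    (f : nat -> nat -> 'M[K]_p) (z : K) : 'M[K]_p :=
  (1 + 'i * z) *: limn (axis_series f z) - 2^-1 *: f 0%N 0%N.

Definition has_characteristic_function (K : numClosedFieldType) p
    (f : nat -> nat -> 'M[K]_p) (phi : ratmx K p) : Prop :=
  \forall z \near (0 : K),
    [/\ ~~ ratmx_pole phi (sigma z),
        cvgn (axis_series f z)
      & ratmx_eval phi (sigma z) = Phi f z].

(* Main.v *)
Require Import Defs.
From mathcomp Require Import all_boot all_order all_algebra.
From mathcomp Require Import all_classical all_reals all_analysis.

(** Put [T = sqrt 2 A^-1 - i].  Since
    [(1 + i z) (A - sigma z) = A (1 - z T)], substituting [sigma z] for the
    variable turns the given realization into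
    [phi (sigma z) = (1 + i z) C (1 - z T)^-1 C* - C C* / 2]
    ([cayley_sigma]).  By definition of the characteristic function the left
    hand side is [(1 + i z) S(z) - f(0,0) / 2], where [S(z)] is the sum of
    [f(m,0) z^m].  At [z = 0] this gives [f(0,0) = C C*], so that
    [S(z) = C (1 - z T)^-1 C*] near the origin
    ([characteristic_function_series]).  The right hand side expands as the
    Neumann series of the [z^m C T^m C*], and the theorem follows by comparing
    coefficients.

    The comparison is done with finite Taylor expansions, so that no infinite
    matrix series is ever summed.  If a power series converges near 0, its
    partial sums approximate the sum up to [O(z^k)]
    ([power_series_remainder]); so do the partial sums of the Neumann series,
    because [(1 - z T)^-1 - sum_(m < k) z^m T^m = z^k (1 - z T)^-1 T^k] and the
    resolvent is bounded near 0 ([resolvent_remainder]).  Two such families of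
    expansions of one function have the same coefficients
    ([power_series_coef_unique]). *)

Set Implicit Arguments.
Unset Strict Implicit.
Unset Printing Implicit Defensive.

Local Open Scope ring_scope.

(** * Coefficients of convergent power series *)

Lemma sum_geometric_half_le (K : numFieldType) (x : K) (k n : nat) :
  0 <= x <= 2^-1 -> \sum_(k <= m < n) x ^+ m <= 2 * x ^+ k.
Proof.
move=> /andP[x0 xh].
have x1 : x <= 1 by rewrite (le_trans xh)// invf_le1// ler1n.
have [kn|nk] := leqP k n; last first.
  by rewrite big_geq ?mulr_ge0 ?exprn_ge0// ltnW.
suff : \sum_(k <= m < n) x ^+ m <= 2 * x ^+ k - 2 * x ^+ n.
  by move=> /le_trans; apply; rewrite gerBl mulr_ge0 ?exprn_ge0.
(* [2 x^k - 2 x^n] is the sum of the [2 x^m (1 - x)], each at least [x^m]. *)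
rewrite -opprB -mulrBr -(telescope_sumr (fun m => x ^+ m)) // mulr_sumr -sumrN.
apply: ler_sum => m _; rewrite -mulrN opprB exprSr -{2}(mulr1 (x ^+ m)) -mulrBr.
rewrite mulrCA -{1}(mulr1 (x ^+ m)) ler_wpM2l ?exprn_ge0//.
rewrite mulrBr mulr1 lerBrDr -[leRHS]/(1 + 1) lerD2l.
by rewrite -ler_pdivlMl// mulr1.
Qed.

(** Convergence at one point [r] bounds the terms by [M / r^m]; on
    [|z| <= r / 2] the tail from index [k] is then dominated by a geometric
    series of ratio [|z| / r <= 1 / 2]. *)
Lemma power_series_remainder (K : numFieldType) (a : nat -> K) (F : K -> K) :
  (\forall z \near (0 : K), series (fun m => z ^+ m * a m) @ \oo --> F z) ->
  forall k, exists B, \forall z \near (0 : K),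
    `|F z - \sum_(0 <= m < k) z ^+ m * a m| <= B * `|z| ^+ k.
Proof.
move=> /nbhs_ballP[e /= e0 eF] k.
set r := e / 2; have r0 : 0 < r by rewrite divr_gt0.
have re : r < e by rewrite ltr_pdivrMr// ltr_pMr// ltr1n.
have : bounded_fun (fun m => r ^+ m * a m).
  apply: cvg_seq_bounded; apply/cvg_ex; exists 0; apply: cvg_series_cvg_0.
  apply/cvg_ex; exists (F r); apply: eF.
  by rewrite -ball_normE/= sub0r normrN gtr0_norm.
move=> /pinfty_ex_gt0[M _ Mb].
have aM m : `|r ^+ m * a m| <= M by exact: Mb.
have M0 : 0 <= M by exact: le_trans (normr_ge0 _) (aM 0%N).
exists (M * 2 / r ^+ k).
apply/nbhs_ballP; exists (r / 2); first by rewrite /= divr_gt0.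
move=> z; rewrite -ball_normE/= sub0r normrN => zr.
have xh : 0 <= `|z| / r <= 2^-1.
  by rewrite divr_ge0 ?(ltW r0)//= ler_pdivrMr// mulrC ltW.
have zF : series (fun m => z ^+ m * a m) @ \oo --> F z.
  apply: eF; rewrite -ball_normE/= sub0r normrN (lt_trans zr)//.
  by rewrite (lt_trans _ re)// ltr_pdivrMr// ltr_pMr// ltr1n.
(* The bound on the partial sums passes to the limit up to any [d > 0]. *)
apply/ler_addgt0Pl => d d0.
move/cvgrPdist_le : zF => /(_ _ d0) [n0 _ nF].
pose n := maxn n0 k.
have {nF} Fn := nF n (leq_maxl _ _).
rewrite -(subrKA (series (fun m => z ^+ m * a m) n)).
apply: (le_trans (ler_normD _ _)); apply: lerD => //.
rewrite /series/= (big_cat_nat (n := k) (leq0n k) (leq_maxr n0 k))/=.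
rewrite addrAC subrr add0r.
apply: (le_trans (ler_norm_sum _ _ _)).
apply: (@le_trans _ _ (\sum_(k <= m < n) M * (`|z| / r) ^+ m)).
  apply: ler_sum => m _; rewrite (expr_div_n `|z|) mulrCA.
  have rm : 0 < r ^+ m by rewrite exprn_gt0.
  rewrite normrM normrX ler_wpM2l ?exprn_ge0// ler_pdivlMr//.
  by have := aM m; rewrite normrM gtr0_norm// mulrC.
rewrite -mulr_sumr.
have -> : M * 2 / r ^+ k * `|z| ^+ k = M * (2 * (`|z| / r) ^+ k).
  by rewrite (expr_div_n `|z|) -!mulrA; do 2![congr (_ * _)]; exact: mulrC.
by rewrite ler_wpM2l// sum_geometric_half_le.
Qed.

(** The function [F] is described on one side by a convergent power series and
    on the other side only by its Taylor expansions to every order, which is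
    what a resolvent provides directly.  If the coefficients agree below [k],
    subtracting the two expansions of order [k + 1] leaves
    [|z^k (a_k - b_k)| <= B |z|^(k+1)], and dividing by [z^k] forces
    [a_k = b_k]. *)
Lemma power_series_coef_unique (K : numFieldType) (a b : nat -> K) (F : K -> K) :
  (\forall z \near (0 : K), series (fun m => z ^+ m * a m) @ \oo --> F z) ->
  (forall k, exists B, \forall z \near (0 : K),
     `|F z - \sum_(0 <= m < k) z ^+ m * b m| <= B * `|z| ^+ k) ->
  a =1 b.
Proof.
move=> /power_series_remainder aF bF; elim/ltn_ind => k IH.
have [Ba aB] := aF k.+1; have [Bb bB] := bF k.+1.
have : \forall z \near (0 : K),
    `|z ^+ k * (a k - b k)| <= (Ba + Bb) * `|z| ^+ k.+1.
  near=> z.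
  have -> : z ^+ k * (a k - b k) = (F z - \sum_(0 <= m < k.+1) z ^+ m * b m)
      - (F z - \sum_(0 <= m < k.+1) z ^+ m * a m).
    rewrite opprB [RHS]addrC subrKA !big_nat_recr//= mulrBr.
    rewrite (eq_big_nat _ _ (F2 := fun m => z ^+ m * b m)); last first.
      by move=> m /andP[_ mk]; rewrite IH.
    by rewrite opprD addrACA subrr add0r.
  rewrite mulrDl [leRHS]addrC (le_trans (ler_normB _ _))// lerD//.
    by near: z.
  by near: z.
move=> /nbhs_ballP[e /= e0 eab].
apply/eqP; rewrite -subr_eq0 -normr_le0; apply/ler_addgt0Pr => d d0.
pose B : K := `|Ba + Bb| + 1.
have B0 : 0 < B by rewrite ltr_wpDl.
have dB0 : 0 < d / B by rewrite divr_gt0.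
(* The quotient [x y / (x + y)] is a positive element below both [x = d / B]
   and [y = e], chosen without comparing them: [K] is only partially ordered. *)
pose z : K := d / B * e / (d / B + e).
have z0 : 0 < z by apply: divr_gt0; [exact: mulr_gt0 | exact: addr_gt0].
have ze : z < e by rewrite /z ltr_pdivrMr ?addr_gt0// mulrC ltr_pM2l// ltrDl.
have zd : z < d / B.
  by rewrite /z -mulrA gtr_pMr// ltr_pdivrMr ?addr_gt0// mul1r ltrDr.
have {eab} := eab z; rewrite -ball_normE/= sub0r normrN gtr0_norm// => /(_ ze).
rewrite normrM normrX gtr0_norm// exprSr mulrCA ler_pM2l ?exprn_gt0// => abz.
have Bz0 := le_trans (normr_ge0 _) abz.
rewrite add0r (le_trans abz)// -(ger0_norm Bz0) normrM (gtr0_norm z0).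
apply: (@le_trans _ _ (B * z)); first by rewrite ler_pM2r// lerDl.
by rewrite mulrC -ler_pdivlMr// ltW.
Unshelve. all: by end_near. Qed.

(** * The resolvent of a matrix near the origin *)

(** Unlike the maximum of the moduli of the entries, this norm is
    submultiplicative with constant 1, and this for rectangular matrices of
    any size. *)
Definition mxsum_norm (K : numDomainType) m n (M : 'M[K]_(m, n)) : K :=
  \sum_i \sum_j `|M i j|.

Lemma mxsum_norm_ge0 (K : numDomainType) m n (M : 'M[K]_(m, n)) :
  0 <= mxsum_norm M.
Proof. by apply: sumr_ge0 => i _; apply: sumr_ge0. Qed.

Lemma norm_entry_le_mxsum (K : numDomainType) m n (M : 'M[K]_(m, n)) i j :
  `|M i j| <= mxsum_norm M.
Proof.
rewrite /mxsum_norm (bigD1 i)//= (bigD1 j)//= -addrA lerDl addr_ge0 ?sumr_ge0//.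
by move=> k _; apply: sumr_ge0.
Qed.

Lemma mxsum_norm0_eq0 (K : numDomainType) m n (M : 'M[K]_(m, n)) :
  mxsum_norm M = 0 -> M = 0.
Proof.
move=> M0; apply/matrixP => i j; apply/eqP; rewrite mxE -normr_le0 -M0.
exact: norm_entry_le_mxsum.
Qed.

Lemma mxsum_normD (K : numDomainType) m n (M P : 'M[K]_(m, n)) :
  mxsum_norm (M + P) <= mxsum_norm M + mxsum_norm P.
Proof.
rewrite /mxsum_norm -big_split; apply: ler_sum => i _ /=.
by rewrite -big_split; apply: ler_sum => j _; rewrite mxE ler_normD.
Qed.

Lemma mxsum_normZ (K : numDomainType) m n (z : K) (M : 'M[K]_(m, n)) :
  mxsum_norm (z *: M) = `|z| * mxsum_norm M.
Proof.
rewrite /mxsum_norm mulr_sumr; apply: eq_bigr => i _.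
by rewrite mulr_sumr; apply: eq_bigr => j _; rewrite mxE normrM.
Qed.

Lemma mxsum_normM (K : numDomainType) m n p
    (M : 'M[K]_(m, n)) (P : 'M[K]_(n, p)) :
  mxsum_norm (M *m P) <= mxsum_norm M * mxsum_norm P.
Proof.
rewrite /mxsum_norm mulr_suml; apply: ler_sum => i _.
apply: (@le_trans _ _ (\sum_k \sum_j `|M i j| * `|P j k|)).
  apply: ler_sum => k _; rewrite mxE; apply: (le_trans (ler_norm_sum _ _ _)).
  by apply: ler_sum => j _; rewrite normrM.
rewrite exchange_big mulr_suml; apply: ler_sum => j _ /=.
rewrite -mulr_sumr ler_wpM2l// [leRHS](bigD1 j)//= lerDl.
by apply: sumr_ge0 => k _; apply: sumr_ge0.
Qed.

Section Resolvent.
Variables (K : numFieldType) (N : nat) (T : 'M[K]_N).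

Lemma near0_norm_scale_le_half :
  \forall z \near (0 : K), `|z| * mxsum_norm T <= 2^-1.
Proof.
have t0 : 0 < mxsum_norm T + 1 by rewrite ltr_wpDl ?mxsum_norm_ge0.
apply/nbhs_ballP; exists (2^-1 / (mxsum_norm T + 1)).
  by rewrite /= divr_gt0.
move=> z; rewrite -ball_normE/= sub0r normrN ltr_pdivlMr// => /ltW.
apply: le_trans.
by rewrite ler_wpM2l// lerDl.
Qed.

(** A row vector with [v = z v T] has norm at most half of itself, hence vanishes:
    [1 - z T] has trivial kernel. *)
Lemma near0_resolvent_unit :
  \forall z \near (0 : K), 1%:M - z *: T \in unitmx.
Proof.
near=> z; rewrite -row_free_unit; apply: inj_row_free => v.
rewrite mulmxBr mulmx1 => /eqP; rewrite subr_eq0 => /eqP vE.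
apply: mxsum_norm0_eq0; apply/le_anti; rewrite mxsum_norm_ge0 andbT.
suff : mxsum_norm v <= mxsum_norm v * 2^-1.
  rewrite -subr_le0 -{1}[mxsum_norm v]mulr1 -mulrBr pmulr_lle0//.
  by rewrite subr_gt0 invf_lt1// ltr1n.
rewrite {1}vE (le_trans (mxsum_normM _ _))// ler_wpM2l ?mxsum_norm_ge0//.
by rewrite mxsum_normZ; near: z; exact: near0_norm_scale_le_half.
Unshelve. all: by end_near. Qed.

(** The resolvent satisfies [S = 1 + z T S], where the last term contributes
    at most half the norm of [S]. *)
Lemma near0_resolvent_bounded :
  \forall z \near (0 : K),
    mxsum_norm (invmx (1%:M - z *: T)) <= 2 * mxsum_norm (1%:M : 'M[K]_N).
Proof.
near=> z.
have Ru : 1%:M - z *: T \in unitmx by near: z; exact: near0_resolvent_unit.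
set S := invmx _.
have SE : S = 1%:M + z *: T *m S.
  by rewrite -[1%:M](mulmxV Ru) -/S -mulmxDl subrK mul1mx.
have : mxsum_norm S <= mxsum_norm (1%:M : 'M[K]_N) + 2^-1 * mxsum_norm S.
  rewrite {1}SE (le_trans (mxsum_normD _ _))// lerD2l.
  rewrite (le_trans (mxsum_normM _ _))// ler_wpM2r ?mxsum_norm_ge0// mxsum_normZ.
  by near: z; exact: near0_norm_scale_le_half.
rewrite -lerBlDr -{1}[mxsum_norm S]mul1r -mulrBl.
have -> : 1 - 2^-1 = 2^-1 :> K.
  by apply/eqP; rewrite subr_eq -mulr2n -(mulr_natl 2^-1) divff.
by rewrite ler_pdivrMl.
Unshelve. all: by end_near. Qed.

Lemma resolvent_expansion (z : K) k : 1%:M - z *: T \in unitmx ->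
  invmx (1%:M - z *: T) =
    \sum_(0 <= m < k) z ^+ m *: T ^+ m
    + z ^+ k *: (invmx (1%:M - z *: T) *m T ^+ k).
Proof.
move=> Ru; set S := invmx _.
elim: k => [|k {1}->].
  by rewrite big_geq// add0r !expr0 scale1r mulmx1.
rewrite big_nat_recr//= -addrA; congr (_ + _).
have SE : S = 1%:M + z *: (S *m T).
  by rewrite scalemxAr -[1%:M](mulVmx Ru) -/S -mulmxDr subrK mulmx1.
rewrite {1}SE mulmxDl mul1mx scalerDr -scalemxAl -mulmxA scalerA -exprSr.
by rewrite -[T *m _]/(T * T ^+ k) -exprS.
Qed.

Lemma resolvent_remainder p q (C : 'M[K]_(p, N)) (D : 'M[K]_(N, q)) i j k :
  exists B, \forall z \near (0 : K),
    `|(C *m invmx (1%:M - z *: T) *m D) i j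
      - \sum_(0 <= m < k) z ^+ m * (C *m T ^+ m *m D) i j| <= B * `|z| ^+ k.
Proof.
exists (mxsum_norm C * (2 * mxsum_norm (1%:M : 'M[K]_N)) * mxsum_norm (T ^+ k)
        * mxsum_norm D).
near=> z.
have Ru : 1%:M - z *: T \in unitmx by near: z; exact: near0_resolvent_unit.
rewrite {1}(resolvent_expansion k Ru) mulmxDr mulmxDl mxE mulmx_sumr mulmx_suml.
rewrite summxE (eq_bigr (fun m => z ^+ m * (C *m T ^+ m *m D) i j)); last first.
  by move=> m _; rewrite -scalemxAr -scalemxAl mxE.
rewrite addrAC subrr add0r -scalemxAr -scalemxAl mxE normrM normrX mulrC.
rewrite ler_wpM2r ?exprn_ge0// (le_trans (norm_entry_le_mxsum _ _ _))//.
rewrite (le_trans (mxsum_normM _ _))// ler_wpM2r ?mxsum_norm_ge0//.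
rewrite mulmxA (le_trans (mxsum_normM _ _))// ler_wpM2r ?mxsum_norm_ge0//.
rewrite (le_trans (mxsum_normM _ _))// ler_wpM2l ?mxsum_norm_ge0//.
by near: z; exact: near0_resolvent_bounded.
Unshelve. all: by end_near. Qed.

End Resolvent.

(** * From the realization to the generating series *)

(** The matrix factor of the realization is [2 (A - s)^-1 A - 1], and
    [(1 + i z) (A - s) = A (1 - z T)] at [s = sigma z] identifies
    [(A - s)^-1 A] with [(1 + i z) (1 - z T)^-1]. *)
Lemma cayley_sigma (K : numClosedFieldType) N (A : 'M[K]_N) (z : K) :
  let T := sqrtC 2 *: invmx A - 'i%:M in
  A \in unitmx -> 1 + 'i * z != 0 -> 1%:M - z *: T \in unitmx ->
  A - (sigma z)%:M \in unitmx /\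
  invmx (A - (sigma z)%:M) *m (A + (sigma z)%:M) =
    (2 * (1 + 'i * z)) *: invmx (1%:M - z *: T) - 1%:M.
Proof.
move=> T Au w0 Ru; set S := invmx (1%:M - z *: T); set w := 1 + 'i * z.
have sE : sqrtC 2 * z = w * sigma z by rewrite /sigma [RHS]mulrC mulfVK.
have AT : w *: (A - (sigma z)%:M) = A *m (1%:M - z *: T).
  rewrite /T mulmxBr mulmx1 -scalemxAr mulmxBr -scalemxAr mulmxV// mul_mx_scalar.
  rewrite !scalerBr !scalerA [z * sqrtC 2]mulrC sE opprB.
  rewrite -[(sigma z)%:M]scalemx1 scalerA {1}/w scalerDl scale1r.
  by rewrite -addrA ['i * z]mulrC.
have Asu : A - (sigma z)%:M \in unitmx.
  have : A *m (1%:M - z *: T) \in unitmx by rewrite unitmx_mul Au.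
  by rewrite -AT unitmxZ// unitfE.
split=> //.
have -> : A + (sigma z)%:M = 2 *: A - (A - (sigma z)%:M).
  by rewrite opprB addrCA scaler_nat mulr2n addrK addrC.
rewrite mulmxBr mulVmx// -scalemxAr -scalerA; congr (2 *: _ - _).
rewrite -[LHS](mulmxK Ru) -/S -[X in X *m S]mulmxA -AT -scalemxAr mulVmx//.
by rewrite -scalemxAl mul1mx.
Qed.

Lemma axis_series_entry (K : numClosedFieldType) p
    (f : nat -> nat -> 'M[K]_p) (z : K) (L : 'M[K]_p) i j :
  axis_series f z @ \oo --> L ->
  series (fun m => z ^+ m * f m 0%N i j) @ \oo --> L i j.
Proof.
move=> fL.
have -> : series (fun m => z ^+ m * f m 0%N i j)
    = (fun M : 'M[K]_p => M i j) \o axis_series f z.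
  apply/funext => n; rewrite /axis_series /series/= summxE.
  by apply: eq_bigr => m _; rewrite mxE.
exact: cvg_comp fL (@coord_continuous K p p i j L).
Qed.

(** The relation between [phi] and [Phi] determines the sum of the series up to
    the constant [f(0,0) / 2]; evaluating it at [z = 0], where the series sums
    to [f(0,0)], fixes this constant. *)
Lemma characteristic_function_series (K : numClosedFieldType) (p N : nat)
    (A : 'M[K]_N) (C : 'M[K]_(p, N))
    (phi : ratmx K p) (f : nat -> nat -> 'M[K]_p) :
  let T := sqrtC 2 *: invmx A - 'i%:M in
  A \in unitmx -> realizes phi A C -> has_characteristic_function f phi ->
  \forall z \near (0 : K),
    axis_series f z @ \oo --> C *m invmx (1%:M - z *: T) *m C^t*.
Proof.
move=> T Au phiAC fphi.
pose G z := C *m invmx (1%:M - z *: T) *m C^t*.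
pose L z := limn (axis_series f z).
have w_neq0 : \forall z \near (0 : K), 1 + 'i * z != 0.
  apply/nbhs_ballP; exists 1 => //= z; rewrite -ball_normE/= sub0r normrN => z1.
  apply/eqP => /eqP; rewrite addrC addr_eq0 => /eqP/(congr1 Num.norm).
  rewrite normrM normCi mul1r normrN1 => zE.
  by rewrite zE ltxx in z1.
have LG : \forall z \near (0 : K),
    (1 + 'i * z) *: L z - 2^-1 *: f 0%N 0%N
    = (1 + 'i * z) *: G z - 2^-1 *: (C *m C^t*).
  near=> z.
  have Ru : 1%:M - z *: T \in unitmx by near: z; exact: near0_resolvent_unit.
  have w0 : 1 + 'i * z != 0 by near: z.
  have [regz _ phiE] : [/\ ~~ ratmx_pole phi (sigma z), cvgn (axis_series f z)
    & ratmx_eval phi (sigma z) = Phi f z] by near: z.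
  have [Asu cayley] := cayley_sigma Au w0 Ru.
  rewrite -[LHS]/(Phi f z) -phiE (phiAC _ regz Asu) -(mulmxA C) cayley.
  rewrite mulmxBr mulmxBl mulmx1 -scalemxAr -scalemxAl scalerBr scalerA mulrA.
  by rewrite mulVf ?mul1r.
have fL : \forall z \near (0 : K), axis_series f z @ \oo --> L z.
  by apply: filterS fphi => z [].
(* The remainder estimate of order 1 vanishes at [z = 0]. *)
have L0 : L 0 = f 0%N 0%N.
  apply/matrixP => i j; apply/eqP; rewrite -subr_eq0 -normr_le0.
  have [|B] := @power_series_remainder _ (fun m => f m 0%N i j)
    (fun z => L z i j) _ 1%N.
    by apply: filterS fL => z; exact: axis_series_entry.
  by move=> /nbhs_singleton; rewrite big_nat1 expr0 mul1r normr0 expr1 mulr0.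
have f00 : f 0%N 0%N = C *m C^t*.
  have h0 : 1 - 2^-1 != 0 :> K by rewrite subr_eq0 eq_sym invr_eq1 pnatr_eq1.
  apply: (scalerI h0); rewrite !scalerBl !scale1r.
  have := nbhs_singleton LG; rewrite L0 /G mulr0 addr0 scale0r subr0 invmx1.
  by rewrite mulmx1 !scale1r.
near=> z.
have w0 : 1 + 'i * z != 0 by near: z.
have -> : C *m invmx (1%:M - z *: T) *m C^t* = L z.
  apply: (scalerI w0); apply: (addIr (- (2^-1 *: f 0%N 0%N))).
  by rewrite {1}f00; apply/esym; near: z.
by near: z.
Unshelve. all: by end_near. Qed.

Theorem proposition5p4 (R : realType) (p N : nat)
    (A : 'M[cplx R]_N) (C : 'M[cplx R]_(p, N))
    (phi : ratmx (cplx R) p) (f : nat -> nat -> 'M[cplx R]_p) :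
  A \is unitarymx ->
  lossless phi ->
  minimal_realization phi A C ->
  symmetric_da f ->
  discrete_analytic f ->
  has_characteristic_function f phi ->
  forall m : nat,
    f m 0%N = C *m (sqrtC 2 *: invmx A - 'i%:M) ^+ m *m C^t*.
Proof.
move=> /unitarymx_unit Au _ [phiAC _] _ _ fphi m.
apply/matrixP => i j; move: m.
apply: power_series_coef_unique; last first.
  by move=> k; exact: resolvent_remainder.
by apply: filterS (characteristic_function_series Au phiAC fphi) => z;
   exact: axis_series_entry.
Qed.
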